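(* Let $\Sigma$ be a renamed-apart rule set and $\mathcal{D}$ a database such that $\Sigma$ and $\mathcal{D}$ have a core model, and let $q$ be a normal Boolean conjunctive query that is affection-safe with respect to $\Sigma$. Let $\mathcal{M}$ be any chase of $\Sigma$ and $\mathcal{D}$ computed by a chase procedure compatible with jointly affected positions (e.g. the restricted, Skolem or oblivious chase). Then $\Sigma,\mathcal{D}\models_c q$ if and only if $\mathcal{M}\models q$.
   Context: Fix pairwise disjoint sets of constants, nulls, variables and predicates with arities. An interpretation is a set of variable-free atoms; a database is a finite set of ground (constant-only) atoms. An existential rule is $\forall\vec x,\vec y.\,\varphi[\vec x,\vec y]\to\exists\vec z.\,\psi[\vec y,\vec z]$ (body/head conjunctions of atoms, frontier $\vec y$ occurring in the body); a rule set is a finite set of rules, renamed-apart if no variable occurs in two rules. Homomorphisms fix constants and preserve atoms; isomorphisms are bijective homomorphisms with homomorphic inverse. A model of $\Sigma$ and $\mathcal{D}$ is an interpretation containing $\mathcal{D}$ in which every homomorphism from a rule body extends to one of the rule head; universal models map homomorphically into every model. A finite interpretation is a core if all its endomorphisms are isomorphisms; a core model is a finite universal model that is a core. Restricted chase: $\mathcal{D}^0=\mathcal{D}$, $\mathcal{D}^{i+1}=\mathcal{D}^i\cup h^\star(\mathrm{head}(\rho))$ for a rule $\rho\in\Sigma$ and a match $h$ of its body in $\mathcal{D}^i$ that does not extend to a homomorphism of the head into $\mathcal{D}^i$, where $h^\star$ maps existential variables to fresh nulls; fair (every match is eventually satisfied); the chase is the union. (Skolem and oblivious chases differ only in when a match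 may be applied.) A chase procedure is compatible with jointly affected positions if its results are universal models of $\Sigma$ and $\mathcal{D}$ in which nulls only occur at jointly affected positions. Positions: $\langle p,i\rangle$, $1\le i\le\mathrm{ar}(p)$. For a variable $x$ of $\Sigma$, $\Pi^B_x$ ($\Pi^H_x$) is the set of positions where $x$ occurs in the body (head) of its rule. For an existentially quantified $x$, $\Omega_x$ is the smallest set of positions containing $\Pi^H_x$ such that for every universally quantified $y$, $\Pi^B_y\subseteq\Omega_x$ implies $\Pi^H_y\subseteq\Omega_x$. Jointly affected positions are $\bigcup_x\Omega_x$ over existential $x$. A normal Boolean conjunctive query (BNCQ) is $q=\exists\vec x.\,\varphi\wedge\psi$, $\varphi$ a conjunction of atoms (set $q^+$), $\psi$ a conjunction of negated atoms (set $q^-$ of the un-negated atoms) with variables occurring in $\varphi$, $q^+\cap q^-=\emptyset$; $I\models q$ iff some homomorphism $h:q^+\to I$ has $h(q^-)\cap I=\emptyset$. $q$ is affection-safe w.r.t. $\Sigma$ if every variable in $q^-$ occurs at a position in $q^+$ that is not jointly affected. $\Sigma,\mathcal{D}\models_c q$ means some core model of $\Sigma$ and $\mathcal{D}$ satisfies $q$. *)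

(* Defs.v *)
From mathcomp Require Import all_boot.
From mathcomp Require Import boolp classical_sets functions cardinality.

Set Implicit Arguments.
Unset Strict Implicit.
Unset Printing Implicit Defensive.

Local Open Scope classical_set_scope.

(* The four sets are arbitrary, in particular possibly uncountable; being
   distinct types, they are disjoint. *)
Record vocabulary := Vocabulary {
  const : Type;
  null : Type;
  var : Type;
  pred : Type;
  ar : pred -> nat
}.

Section Syntax.
Variable S : vocabulary.

Inductive term : Type :=
| Cst of const S
| Nul of null S
| Var of var S.

Record atom : Type := Atom { apred : pred S; aargs : (ar apred).-tuple term }.

(* The i-th position of p is numbered from 0. *)
Definition position : Type := {p : pred S & 'I_(ar p)}.

Definition occurs_at (A : set atom) (t : term) : set position :=
  [set pi | exists (a : atom) (i : 'I_(ar (apred a))),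
     [/\ A a, tnth (aargs a) i = t & pi = existT _ (apred a) i]].

Definition terms (A : set atom) : set term :=
  [set t | exists pi, occurs_at A t pi].

Definition vars (A : set atom) : set (var S) := [set x | terms A (Var x)].

Definition null_free (A : set atom) : Prop := forall n, ~ terms A (Nul n).

Definition interpretation (I : set atom) : Prop := forall x, ~ terms I (Var x).

Definition database (D : set atom) : Prop :=
  finite_set D /\ forall t, terms D t -> exists c, t = Cst c.

Definition amap (h : term -> term) (a : atom) : atom :=
  Atom (map_tuple h (aargs a)).

(* A homomorphism is a total map on terms, of which only the values on the terms
   of A matter; every map on the terms of A that fixes constants extends to
   such a total map. *)
Definition hom (h : term -> term) (A B : set atom) : Prop :=
  (forall c, h (Cst c) = Cst c) /\ forall a, A a -> B (amap h a).

Definition isomorphism (h : term -> term) (A B : set atom) : Prop :=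
  [/\ hom h A B, set_bij (terms A) (terms B) h &
      exists2 g, hom g B A & forall t, terms A t -> g (h t) = t].

(* The conjunctions in rules and queries contain no nulls. Quantifiers are left
   implicit: the universal variables of a rule are those of its body, and the
   existential ones those that occur in its head only. *)
Record rule : Type := Rule {
  rbody : set atom;
  rhead : set atom;
  rbody_finite : finite_set rbody;
  rhead_finite : finite_set rhead;
  rbody_null_free : null_free rbody;
  rhead_null_free : null_free rhead
}.

Definition uvars (r : rule) : set (var S) := vars (rbody r).
Definition frontier (r : rule) : set (var S) := vars (rbody r) `&` vars (rhead r).
Definition evars (r : rule) : set (var S) := vars (rhead r) `\` vars (rbody r).

Definition renamed_apart (Sigma : set rule) : Prop :=
  forall r1 r2 x, Sigma r1 -> Sigma r2 ->
    vars (rbody r1 `|` rhead r1) x -> vars (rbody r2 `|` rhead r2) x -> r1 = r2.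

(* The match h of the body of r extends to a homomorphism of the head into I. *)
Definition satisfied (r : rule) (h : term -> term) (I : set atom) : Prop :=
  exists2 h', hom h' (rhead r) I & forall x, uvars r x -> h' (Var x) = h (Var x).

Definition model (Sigma : set rule) (D I : set atom) : Prop :=
  [/\ interpretation I, D `<=` I &
      forall r h, Sigma r -> hom h (rbody r) I -> satisfied r h I].

Definition universal_model (Sigma : set rule) (D I : set atom) : Prop :=
  model Sigma D I /\ forall J, model Sigma D J -> exists h, hom h I J.

Definition core (I : set atom) : Prop :=
  [/\ interpretation I, finite_set I & forall h, hom h I I -> isomorphism h I I].

Definition core_model (Sigma : set rule) (D I : set atom) : Prop :=
  [/\ finite_set I, universal_model Sigma D I & core I].

(* For renamed-apart Sigma, at most one rule contributes to each of these sets. *)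
Definition body_positions (Sigma : set rule) (x : var S) : set position :=
  \bigcup_(r in Sigma) occurs_at (rbody r) (Var x).
Definition head_positions (Sigma : set rule) (x : var S) : set position :=
  \bigcup_(r in Sigma) occurs_at (rhead r) (Var x).

Definition propagation_closed (Sigma : set rule) (O : set position) : Prop :=
  forall y, (\bigcup_(r in Sigma) uvars r) y ->
    body_positions Sigma y `<=` O -> head_positions Sigma y `<=` O.

Definition Omega (Sigma : set rule) (x : var S) : set position :=
  smallest (propagation_closed Sigma) (head_positions Sigma x).

Definition jointly_affected (Sigma : set rule) : set position :=
  \bigcup_(x in \bigcup_(r in Sigma) evars r) Omega Sigma x.

Record bncq : Type := BNCQ {
  qpos : set atom;
  qneg : set atom;
  qpos_finite : finite_set qpos;
  qneg_finite : finite_set qneg;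
  qpos_null_free : null_free qpos;
  qneg_null_free : null_free qneg;
  qneg_safe : vars qneg `<=` vars qpos;
  qpos_qneg_disjoint : qpos `&` qneg = set0
}.

Definition entails (I : set atom) (q : bncq) : Prop :=
  exists2 h, hom h (qpos q) I & (amap h @` qneg q) `&` I = set0.

Definition affection_safe (Sigma : set rule) (q : bncq) : Prop :=
  forall x, vars (qneg q) x ->
    exists2 pi, occurs_at (qpos q) (Var x) pi & ~ jointly_affected Sigma pi.

Definition core_entails (Sigma : set rule) (D : set atom) (q : bncq) : Prop :=
  exists2 K, core_model Sigma D K & entails K q.

(* A chase procedure is nondeterministic: [chase Sigma D M] means that M is one
   of its results on Sigma and D. *)
Definition chase_procedure : Type := set rule -> set atom -> set atom -> Prop.

Definition compatible (chase : chase_procedure) : Prop :=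
  forall Sigma D M,
    finite_set Sigma -> renamed_apart Sigma -> database D -> chase Sigma D M ->
    universal_model Sigma D M /\
    forall n pi, occurs_at M (Nul n) pi -> jointly_affected Sigma pi.

(* hs extends the match h of the body of r by mapping the existential variables
   to pairwise distinct nulls that do not occur in I. *)
Definition fresh_extension (r : rule) (h : term -> term) (I : set atom)
    (hs : term -> term) : Prop :=
  [/\ forall c, hs (Cst c) = Cst c,
      forall x, uvars r x -> hs (Var x) = h (Var x),
      forall z, evars r z -> exists2 n, hs (Var z) = Nul n & ~ terms I (Nul n) &
      forall z z', evars r z -> evars r z' -> hs (Var z) = hs (Var z') -> z = z'].

(* The sets D^i of a derivation and the rule and match applied at each step;
   [None] is an idle step, so that terminating chases are also infinite
   sequences. *)
Record derivation : Type := Derivation {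
  stage : nat -> set atom;
  applied : nat -> option (rule * (term -> term))
}.

(* [may d i r h] tells whether the match h of the body of r may be applied at
   step i. *)
Definition applicability : Type :=
  derivation -> nat -> rule -> (term -> term) -> Prop.

Definition restricted : applicability := fun d i r h => ~ satisfied r h (stage d i).

Definition oblivious : applicability := fun d i r h =>
  ~ exists j h', [/\ (j < i)%N, applied d j = Some (r, h') &
                     forall x, uvars r x -> h' (Var x) = h (Var x)].

(* Matches that agree on the frontier yield the same Skolem terms; here each such
   class of matches is applied at most once, with fresh nulls in place of Skolem
   terms. *)
Definition skolem : applicability := fun d i r h =>
  ~ exists j h', [/\ (j < i)%N, applied d j = Some (r, h') &
                     forall x, frontier r x -> h' (Var x) = h (Var x)].

Definition chase_step (may : applicability) (Sigma : set rule) (d : derivation)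
    (i : nat) : Prop :=
  match applied d i with
  | None => stage d i.+1 = stage d i
  | Some (r, h) =>
      [/\ Sigma r, hom h (rbody r) (stage d i), may d i r h &
          exists2 hs, fresh_extension r h (stage d i) hs &
            stage d i.+1 = stage d i `|` amap hs @` rhead r]
  end.

(* An application satisfies its match, so every derivation that eventually applies
   or blocks each match is fair, whatever the applicability condition. *)
Definition fair (Sigma : set rule) (d : derivation) : Prop :=
  forall i r h, Sigma r -> hom h (rbody r) (stage d i) ->
    exists2 j, (i <= j)%N & satisfied r h (stage d j).

Definition chase_with (may : applicability) : chase_procedure := fun Sigma D M =>
  exists d, [/\ stage d 0%N = D, forall i, chase_step may Sigma d i,
                fair Sigma d & M = \bigcup_i stage d i].

Definition restricted_chase : chase_procedure := chase_with restricted.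
Definition skolem_chase : chase_procedure := chase_with skolem.
Definition oblivious_chase : chase_procedure := chase_with oblivious.

End Syntax.

(* Main.v *)
Require Import Defs.
From mathcomp Require Import all_boot.
From mathcomp Require Import boolp classical_sets functions cardinality.

(** Let [K] be a core model and [M] a chase; universality gives homomorphisms
    [k : K -> M] and [m : M -> K], and [m \o k] is an automorphism of [K].
    A match [h] of [q] in [K] gives the match [k \o h] in [M]: a negated atom
    mapped into [M] would be mapped by [m] into [K], hence would already be in
    [K] under [h].  Conversely, if [h] is a match in [M], affection-safety makes
    the image of each negated atom ground, so [m \o h] and [h] agree on it, and
    [k] transports ground atoms of [K] to [M].

    For the concrete chases, the homomorphism into a given model is built stage
    by stage, and each null has all its occurrences within [Omega] of the
    existential variable that created it.  Neither argument depends on when a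
    match may be applied. *)

Set Implicit Arguments.
Unset Strict Implicit.
Unset Printing Implicit Defensive.

Local Open Scope classical_set_scope.

(** * Occurrences of terms and homomorphisms *)

Section Homomorphisms.
Variable S : vocabulary.
Implicit Types (A B C : set (atom S)) (a : atom S) (f g h : term S -> term S).

Lemma occurs_terms A t pi : occurs_at A t pi -> terms A t.
Proof. by exists pi. Qed.

Lemma tnth_terms A a i : A a -> terms A (tnth (aargs a) i).
Proof. by move=> Aa; exists (existT _ (apred a) i), a, i. Qed.

Lemma occurs_sub A B : A `<=` B -> forall t, occurs_at A t `<=` occurs_at B t.
Proof. by move=> AB t _ [a [i [/AB Ba <- ->]]]; exists a, i. Qed.

Lemma terms_sub A B : A `<=` B -> terms A `<=` terms B.
Proof. by move=> AB t [pi /(occurs_sub AB) ?]; exists pi. Qed.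

Lemma occurs_setU A B t pi :
  occurs_at (A `|` B) t pi -> occurs_at A t pi \/ occurs_at B t pi.
Proof. by move=> [a [i [[Aa|Ba] <- ->]]]; [left|right]; exists a, i. Qed.

Lemma occurs_image h A t pi :
  occurs_at (amap h @` A) t pi -> exists2 s, occurs_at A s pi & h s = t.
Proof.
case=> b [i [[a Aa ab]]]; rewrite -{}ab in i * => <- ->.
exists (tnth (aargs a) i); first by exists a, i.
by rewrite tnth_map.
Qed.

Lemma hom_occurs h A B t : hom h A B -> occurs_at A t `<=` occurs_at B (h t).
Proof.
move=> [_ hAB] _ [a [i [Aa <- ->]]]; exists (amap h a), i; split => //.
  exact: hAB.
by rewrite tnth_map.
Qed.

Lemma hom_terms h A B t : hom h A B -> terms A t -> terms B (h t).
Proof. by move=> hAB [pi /(hom_occurs hAB) ?]; exists pi. Qed.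

Lemma eq_amap f g a :
  (forall i, f (tnth (aargs a) i) = g (tnth (aargs a) i)) -> amap f a = amap g a.
Proof.
by move=> fg; congr Atom; apply: eq_from_tnth => i; rewrite !tnth_map fg.
Qed.

Lemma amap_comp f g a : amap (f \o g) a = amap f (amap g a).
Proof. by congr Atom; apply: eq_from_tnth => i; rewrite !tnth_map. Qed.

Lemma amap_id a : amap id a = a.
Proof.
by case: a => p s; congr Atom; apply: eq_from_tnth => i; rewrite tnth_map.
Qed.

Lemma hom_comp f g A B C : hom g A B -> hom f B C -> hom (f \o g) A C.
Proof.
move=> [gc gAB] [fc fBC]; split => [c|a Aa] /=; first by rewrite gc fc.
by rewrite amap_comp; apply/fBC/gAB.
Qed.

Lemma eq_hom f g A B :
  (forall c, g (Cst c) = Cst c) -> (forall t, terms A t -> f t = g t) ->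
  hom f A B -> hom g A B.
Proof.
move=> gc fg [_ fAB]; split => // a Aa; rewrite -(@eq_amap f); first exact: fAB.
by move=> i; apply/fg/tnth_terms.
Qed.

Lemma null_freeP A t : null_free A -> terms A t ->
  (exists c, t = Cst c) \/ exists2 x, t = Var x & vars A x.
Proof.
case: t => [c|n|x] nfA At; first by left; exists c.
  by case: (nfA n).
by right; exists x.
Qed.

Lemma head_term (r : rule S) (s : term S) : terms (rhead r) s ->
  [\/ exists c, s = Cst c, exists2 x, s = Var x & uvars r x |
      exists2 z, s = Var z & evars r z].
Proof.
move=> /(null_freeP (@rhead_null_free _ r)) [[c ->]|[x -> hx]].
  by constructor 1; exists c.
have [ux|nux] := pselect (uvars r x); first by constructor 2; exists x.
by constructor 3; exists x.
Qed.

End Homomorphisms.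

(** * Comparing a core model with a universal model *)

Section CoreEntailment.
Variables (S : vocabulary) (Sigma : set (rule S)) (D M : set (atom S)).
Variable q : bncq S.
Hypothesis univM : universal_model Sigma D M.

Lemma core_entails_universal : core_entails Sigma D q -> entails M q.
Proof.
move=> [K [_ [modK univK] [_ _ coreK]] [h hqK hneg]].
have [k kKM] := univK _ univM.1; have [m mMK] := univM.2 _ modK.
(* As [K] is a core, its endomorphism [m \o k] has an inverse [g]. *)
have [_ _ [g gKK gK]] := coreK _ (hom_comp kKM mMK).
exists (k \o h); first exact: hom_comp kKM.
rewrite -subset0 => _ [[a qa <-]] khaM.
suff : set0 (amap h a) by [].
rewrite -hneg; split; first by exists a.
(* Pushing the atom from [M] into [K] by [m] and undoing [m \o k] by [g] recovers [amap h a],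
   because [h] sends the variables of [a] to terms of [K]. *)
suff -> : amap h a = amap g (amap m (amap (k \o h) a)).
  by apply: gKK.2; apply: mMK.2.
rewrite -!amap_comp; apply: eq_amap => i /=; apply/esym.
case: (null_freeP (@qneg_null_free _ q) (tnth_terms i qa)) => [[c ->]|[x -> qx]].
  by rewrite !(hqK.1, kKM.1, mMK.1, gKK.1).
by apply: gK; apply: hom_terms hqK _; apply: qneg_safe.
Qed.

Lemma universal_core_entails :
  (forall n pi, occurs_at M (Nul n) pi -> jointly_affected Sigma pi) ->
  (exists K, core_model Sigma D K) -> affection_safe Sigma q ->
  entails M q -> core_entails Sigma D q.
Proof.
move=> affM [K coreK] safe [h hqM hneg]; exists K => //.
have [_ [modK univK] _] := coreK.
have [k kKM] := univK _ univM.1; have [m mMK] := univM.2 _ modK.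
exists (m \o h); first exact: hom_comp mMK.
rewrite -subset0 => _ [[a qa <-]] mhaK.
(* A variable of a negated atom has a position in [qpos q] that is not jointly affected. Its image
   sits there in [M], so it is no null. *)
have ground i : exists c, h (tnth (aargs a) i) = Cst c.
  case: (null_freeP (@qneg_null_free _ q) (tnth_terms i qa)) => [[c ->]|[x -> qx]].
    by exists c; rewrite hqM.1.
  have [pi /(hom_occurs hqM)] := safe _ qx.
  case: (h (Var x)) => [c|n|y] hx naff; first by exists c.
    by case: naff; apply: affM hx.
  by case: univM.1 => /(_ y) + _ _; case; apply: occurs_terms hx.
suff : set0 (amap h a) by [].
rewrite -hneg; split; first by exists a.
suff -> : amap h a = amap k (amap (m \o h) a) by apply: kKM.2.
rewrite -amap_comp; apply: eq_amap => i /=; have [c ->] := ground i.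
by rewrite mMK.1 kKM.1.
Qed.

End CoreEntailment.

(** * Closure properties of jointly affected positions *)

Section JointlyAffected.
Variables (S : vocabulary) (Sigma : set (rule S)).

Lemma Omega_head x : head_positions Sigma x `<=` Omega Sigma x.
Proof. by move=> pi hpi O [_]; apply. Qed.

Lemma Omega_closed x : propagation_closed Sigma (Omega Sigma x).
Proof.
move=> y Sy By pi Hpi O [cO xO]; apply: (cO _ Sy) Hpi => pi' /By; apply.
by split.
Qed.

(** Since no other rule mentions [y], a match of the single rule [r] reaches all positions that the
    closure condition of [Omega] inspects. *)
Lemma body_positions_renamed_apart r y :
  renamed_apart Sigma -> Sigma r -> uvars r y ->
  body_positions Sigma y `<=` occurs_at (rbody r) (Var y).
Proof.
move=> ra Sr ry pi [r' Sr' y'].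
suff -> : r = r' by [].
apply: (ra _ _ y) => //; [move: ry|move: (occurs_terms y')];
  by apply: terms_sub => ?; left.
Qed.

End JointlyAffected.

(** * Stages of an arbitrary chase *)

Section Chase.
Variables (S : vocabulary) (may : applicability S) (Sigma : set (rule S)).
Variables (D : set (atom S)) (d : derivation S).
Hypotheses (stage0 : stage d 0%N = D) (step : forall i, chase_step may Sigma d i).

(** The applicability condition is forgotten here, so what follows covers all chase variants at
    once. *)
Variant step_spec (i : nat) : Prop :=
| IdleStep of stage d i.+1 = stage d i
| RuleStep r h hs of Sigma r & hom h (rbody r) (stage d i) &
    fresh_extension r h (stage d i) hs &
    stage d i.+1 = stage d i `|` amap hs @` rhead r.

Lemma stepP i : step_spec i.
Proof.
have := step i; rewrite /chase_step.
case: (applied d i) => [[r h] [Sr hr _ [hs fr e]]|]; last exact: IdleStep.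
exact: RuleStep Sr hr fr e.
Qed.

Lemma stage_sub i j : (i <= j)%N -> stage d i `<=` stage d j.
Proof.
move=> /subnK <-; elim: (j - i)%N => // n IH a /IH; rewrite addSn.
by case: (stepP (n + i)) => [->//|r h hs _ _ _ ->]; left.
Qed.

Lemma stage_limit i : stage d i `<=` \bigcup_j stage d j.
Proof. by move=> a; exists i. Qed.

(** * The limit is a model *)

Section Limit.
Hypothesis dbD : database D.

Lemma stage_interpretation i : interpretation (stage d i).
Proof.
elim: i => [|i IH] x; first by rewrite stage0 => /dbD.2 [].
case: (stepP i) => [->|r h hs _ hr [hsc hsu hse _] ->]; first exact: IH.
move=> [pi /occurs_setU[/occurs_terms/IH//|/occurs_image[s /occurs_terms]]].
move=> /head_term[[c ->]|[y -> ry]|[z -> rz]].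
- by rewrite hsc.
- by rewrite hsu // => hy; apply: (IH x); rewrite -hy; apply: hom_terms hr ry.
- by have [n ->] := hse _ rz.
Qed.

(** The stages increase, so the largest of the finitely many stages at which the image atoms appear
    contains them all. This brings body matches in the limit within reach of [fair]. *)
Lemma finite_hom_stage (A : set (atom S)) h : finite_set A ->
  hom h A (\bigcup_i stage d i) -> exists i, hom h A (stage d i).
Proof.
move=> finA [hc hA].
have /choice[f fA] a : exists i, A a -> stage d i (amap h a).
  have [/hA[i _ ?]|//] := pselect (A a); first by exists i.
  by exists 0%N.
have /finite_seqP[s fs] := finite_image f finA.
exists (\max_(i <- s) i); split => // a Aa.
apply: (@stage_sub (f a)); last exact: fA.
apply: (@leq_bigmax_seq _ s xpredT id) => //.
by have : (f @` A) (f a); [exists a|rewrite fs].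
Qed.

Lemma chase_model : fair Sigma d -> model Sigma D (\bigcup_i stage d i).
Proof.
move=> fd; split.
- by move=> x [pi [a [i [[j _ ja] ax _]]]]; apply: (@stage_interpretation j x);
    rewrite -ax; apply: tnth_terms.
- by rewrite -stage0; apply: stage_limit.
- move=> r h Sr /(finite_hom_stage (@rbody_finite _ r))[i /(fd _ _ _ Sr)].
  move=> [j _ [h' [h'c h'j] h'h]]; exists h' => //; split => // a /h'j.
  exact: stage_limit.
Qed.

(** * The limit maps into every model *)

Section Universality.
Variable J : set (atom S).
Hypothesis modJ : model Sigma D J.

Lemma hom_step i f : hom f (stage d i) J ->
  exists2 g, hom g (stage d i.+1) J & forall t, terms (stage d i) t -> g t = f t.
Proof.
move=> fiJ; case: (stepP i) => [->|r h hs Sr hr [hsc hsu hse hsi] ->].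
  by exists f.
have [_ _ /(_ _ _ Sr (hom_comp hr fiJ))[h' h'J h'h]] := modJ.
(* The map [g] keeps [f] on old terms and sends the fresh null of [z] to [h' (Var z)]; injectivity
   of [hs] on existential variables makes this unambiguous. All other terms default to [f]. *)
have /choice[g gP] t : exists u, (terms (stage d i) t -> u = f t) /\
    (~ terms (stage d i) t ->
      (forall z, evars r z -> hs (Var z) = t -> u = h' (Var z)) /\
      ((forall z, evars r z -> hs (Var z) <> t) -> u = f t)).
  have [it|nit] := pselect (terms (stage d i) t); first by exists (f t).
  have [[z rz zt]|nz] := pselect (exists2 z, evars r z & hs (Var z) = t).
    exists (h' (Var z)); split => // _; split => [z' rz' z't|/(_ z rz)//].
    by rewrite (hsi z z') // zt.
  exists (f t); split => // _; split => // z rz zt.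
  by case: nz; exists z.
have gf t : terms (stage d i) t -> g t = f t by have [] := gP t.
have gc c : g (Cst c) = Cst c.
  have [ic|nic] := pselect (terms (stage d i) (Cst c)).
    by rewrite gf // fiJ.1.
  have [_ /(_ nic)[_ ->]] := gP (Cst c); first exact: fiJ.1.
  by move=> z /hse[n ->].
exists g => //; split => // b [ib|[a ra <-]].
  by apply: (eq_hom gc _ fiJ).2 ib => t /gf.
(* On the terms of the head, [g \o hs] agrees with [h']. *)
rewrite -amap_comp (@eq_amap _ _ h'); first exact: h'J.2.
move=> k /=; case: (head_term (tnth_terms k ra)) => [[c ->]|[y -> ry]|[z -> rz]].
- by rewrite hsc gc h'J.1.
- by rewrite hsu // h'h // gf //; apply: hom_terms hr ry.
- have [n zn nn] := hse _ rz.
  by have [_] := gP (hs (Var z)); rewrite {1}zn => /(_ nn)[/(_ z rz erefl)].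
Qed.

Lemma chase_universal : exists f, hom f (\bigcup_i stage d i) J.
Proof.
have hom0 : hom id (stage d 0%N) J.
  by split => // a; rewrite stage0 amap_id; case: modJ => _ + _; apply.
have /choice[next nextP] (x : nat * (term S -> term S)) : exists g,
    hom x.2 (stage d x.1) J ->
    hom g (stage d x.1.+1) J /\ forall t, terms (stage d x.1) t -> g t = x.2 t.
  have [/hom_step[g]|//] := pselect (hom x.2 (stage d x.1) J); first by exists g.
  by exists id.
pose f := nat_rect (fun=> term S -> term S) id (fun i g => next (i, g)).
have fJ i : hom (f i) (stage d i) J.
  by elim: i => // i /(nextP (i, f i))[].
have f_ext i j t : (i <= j)%N -> terms (stage d i) t -> f j t = f i t.
  move=> ij it; rewrite -(subnK ij); elim: (j - i)%N => // n IH.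
  rewrite -IH; apply: (nextP (n + i, f (n + i)) (fJ _)).2.
  by apply: terms_sub it; apply: stage_sub; apply: leq_addl.
(* Each [f i] extends its predecessors on their stages, so their values glue. *)
have /choice[F FP] t : exists u, forall i, terms (stage d i) t -> u = f i t.
  have [[i it]|nt] := pselect (exists i, terms (stage d i) t); last first.
    by exists t => i it; case: nt; exists i.
  exists (f i t) => j jt.
  by case/orP: (leq_total i j) => ij; [rewrite (f_ext i j)|rewrite (f_ext j i)].
(* [F] is unconstrained on constants that occur in no stage, so constants are fixed by hand. *)
exists (fun t => if t is Cst c then Cst c else F t); split => // a [i _ ia].
rewrite (@eq_amap _ _ (f i)); first exact: (fJ i).2.
move=> k; have := tnth_terms k ia; case: (tnth _ k) => [c|n|x] ki.
- by rewrite (fJ i).1.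
- exact: FP.
- exact: FP.
Qed.

End Universality.
End Limit.

(** * Positions of nulls in the chase *)

Hypotheses (ra : renamed_apart Sigma) (dbD : database D).

(** One [x] must serve all occurrences of the null: propagation through a universal variable
    requires all its body positions to lie in the same [Omega Sigma x]. *)
Lemma stage_null_Omega i n : terms (stage d i) (Nul n) ->
  exists2 x, (\bigcup_(r in Sigma) evars r) x &
    occurs_at (stage d i) (Nul n) `<=` Omega Sigma x.
Proof.
elim: i => [|i IH]; first by rewrite stage0 => /dbD.2[].
case: (stepP i) => [->//|r h hs Sr hr [hsc hsu hse hsi] ->].
have [inn|nin] := pselect (terms (stage d i) (Nul n)).
  have [x ex ox] := IH inn; exists x => // pi /occurs_setU[/ox//|].
  move=> /occurs_image[s os].
  have sP := head_term (occurs_terms os); case: sP os => [[c ->]|[y -> ry]|[z -> rz]] os.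
  - by rewrite hsc.
  (* The match puts the null at every body position of [y]; by induction these lie in
     [Omega Sigma x], and closure adds the head positions. *)
  - rewrite hsu // => hy; apply: (@Omega_closed _ _ x y); first by exists r.
      move=> pi' /(body_positions_renamed_apart ra Sr ry)/(hom_occurs hr).
      by rewrite hy => /ox.
    by exists r.
  - by have [m -> nm] := hse _ rz => - [mn]; rewrite mn in nm.
have new pi : occurs_at (stage d i `|` amap hs @` rhead r) (Nul n) pi ->
    exists z, [/\ evars r z, hs (Var z) = Nul n & occurs_at (rhead r) (Var z) pi].
  move=> /occurs_setU[/occurs_terms//|/occurs_image[s os]].
  have sP := head_term (occurs_terms os); case: sP os => [[c ->]|[y -> ry]|[z -> rz]] os.
  - by rewrite hsc.
  - by rewrite hsu // => hy; case: nin; rewrite -hy; apply: hom_terms hr ry.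
  - by exists z.
(* A null new at this step comes from exactly one existential variable [z], so it occurs only at
   head positions of [z]. *)
move=> [pi0 /new[z [rz zn _]]]; exists z; first by exists r.
move=> pi /new[z' [rz' z'n oz']]; apply: Omega_head; exists r => //.
by rewrite (hsi z z') // zn.
Qed.

Lemma chase_null_affected n pi :
  occurs_at (\bigcup_i stage d i) (Nul n) pi -> jointly_affected Sigma pi.
Proof.
move=> [a [k [[i _ ia] an ->]]].
have on : occurs_at (stage d i) (Nul n) (existT _ (apred a) k) by exists a, k.
by have [x ex ox] := stage_null_Omega (occurs_terms on); exists x => //; apply: ox.
Qed.

End Chase.

Lemma chase_with_compatible (S : vocabulary) (may : applicability S) :
  compatible (chase_with may).
Proof.
move=> Sigma D M _ ra dbD [d [stage0 step fd ->]]; split; last first.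
  exact: chase_null_affected stage0 step ra dbD.
split; first exact: chase_model stage0 step dbD fd.
exact: chase_universal stage0 step.
Qed.

Theorem theorem2 (S : vocabulary) :
  (forall (chase : chase_procedure S) (Sigma : set (rule S)) (D M : set (atom S))
      (q : bncq S),
    compatible chase ->
    finite_set Sigma -> renamed_apart Sigma -> database D ->
    (exists K, core_model Sigma D K) ->
    affection_safe Sigma q ->
    chase Sigma D M ->
    (core_entails Sigma D q <-> entails M q)) /\
  [/\ compatible (@restricted_chase S), compatible (@skolem_chase S) &
      compatible (@oblivious_chase S)].
Proof.
split; last by split; apply: chase_with_compatible.
move=> chase Sigma D M q compat finS ra dbD hasK safe chM.
have [univM affM] := compat _ _ _ finS ra dbD chM.
by split; [apply: core_entails_universal|apply: universal_core_entails].
Qed.
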